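(* Let $f:X\to Y$ be a closed homologically $UV^n(G)$ surjection between paracompact spaces. Then for every open cover $\mathcal U$ of $Y$ there is an open cover $\mathcal V$ of $Y$ refining $\mathcal U$ such that any correct partial algebraic realization of $C(K;G)$ in $f^{-1}(\mathcal V)$, where $K$ is an $(n+1)$-dimensional simplicial complex, extends to a full algebraic realization $\phi:C(K;G)\to S(X;G)$ of $C(K;G)$ in $f^{-1}(\mathcal U)$.
   Context: Conventions: all spaces are paracompact, maps are continuous; $G$ is a commutative ring with unit; $n\ge0$ is an integer; $H_k(\cdot;G)$ is singular homology, reduced in dimension $0$. A closed set $A\subset X$ is homologically $UV^n(G)$ if every neighborhood $U$ of $A$ in $X$ contains another neighborhood $V$ of $A$ such that the inclusion induces trivial homomorphisms $H_k(V;G)\to H_k(U;G)$ for all $k\le n$. A surjective map $f:X\to Y$ is homologically $UV^n(G)$ if all fibres $f^{-1}(y)$, $y\in Y$, are homologically $UV^n(G)$-subsets of $X$. For an open cover $\mathcal V$ of $Y$, $f^{-1}(\mathcal V)=\{f^{-1}(V):V\in\mathcal V\}$. A chain morphism is a sequence of homomorphisms of $G$-modules (degree by degree) commuting with the boundaries and, in degree $0$, with the augmentations. $S(X;G)$ is the singular chain complex of $X$; for a simplicial complex $K$, $C(K;G)$ is its oriented chain complex and $K^{(0)}$ its vertex set. The carrier of a singular simplex $\sigma:\triangle^k\to X$ is $|\sigma|=\sigma(\triangle^k)$; for a chain $c=\sum_i g_i\sigma_i$ (irreducible representation) $|c|=\bigcup_i|\sigma_i|$, and $|0|=\varnothing$.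 For an open cover $\mathcal W$ of $X$, a chain morphism $\varphi:C(L;G)\to S(X;G)$ is a partial algebraic realization of $C(K;G)$ in $\mathcal W$ if $L$ is a subcomplex of $K$ containing $K^{(0)}$ and for every simplex $\sigma\in K$ there is $W_\sigma\in\mathcal W$ with $|\varphi(\tau)|\subset W_\sigma$ for all faces $\tau$ of $\sigma$ with $\tau\in L$; it is a full algebraic realization if $L=K$. It is correct if $\varphi(v)$ is a singular $0$-simplex of $X$ for every vertex $v$. *)

(* Defs.v *)
From HB Require Import structures.
From mathcomp Require Import all_boot all_order all_fingroup all_algebra finmap.
From mathcomp Require Import monalg.
From mathcomp Require Import all_classical all_reals.
From mathcomp Require Import topology.

Set Implicit Arguments.
Unset Strict Implicit.
Unset Printing Implicit Defensive.

Import GRing.Theory Num.Theory.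
Import numFieldTopology.Exports.

Local Open Scope classical_set_scope.
Local Open Scope ring_scope.

(* The library gives {malg G[I]} a G-module structure only when 0 != 1 in G;
   this alias carries one over every commutative ring. *)
Section FreeModule.
Variables (G : comPzRingType) (I : choiceType).

Definition freeMod := {malg G[I]}.

HB.instance Definition _ := Choice.on freeMod.
HB.instance Definition _ := GRing.Zmodule.on freeMod.

Implicit Types c d : freeMod.

Definition fscale (a : G) c : freeMod := [malg x in msupp c => a * c@_x].

Lemma fscaleE a c x : (fscale a c)@_x = a * c@_x.
Proof. by rewrite mcoeffE; case: msuppP; rewrite ?mulr0. Qed.

Lemma fscaleA a b c : fscale a (fscale b c) = fscale (a * b) c.
Proof. by apply/malgP => x; rewrite !fscaleE mulrA. Qed.

Lemma fscale1 : left_id 1 fscale.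
Proof. by move=> c; apply/malgP => x; rewrite fscaleE mul1r. Qed.

Lemma fscaleDr : right_distributive fscale +%R.
Proof.
by move=> a c d; apply/malgP => x; rewrite !(mcoeffD, fscaleE) mulrDr.
Qed.

Lemma fscaleDl c : {morph fscale^~ c : a b / a + b}.
Proof. by move=> a b; apply/malgP => x; rewrite !(mcoeffD, fscaleE) mulrDl. Qed.

HB.instance Definition _ := GRing.Zmodule_isLmodule.Build G freeMod
  fscaleA fscale1 fscaleDr fscaleDl.

Definition gen (x : I) : freeMod := << (1 : G) *g x >>.

Lemma coefZ a c x : (a *: c)@_x = a * c@_x. Proof. exact: fscaleE. Qed.

Lemma coef_gen x y : (gen x)@_y = (x == y)%:R :> G.
Proof. by rewrite mcoeffU. Qed.

(* The linear extension of F : I -> M. *)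
Definition linext (M : lmodType G) (F : I -> M) c : M :=
  \sum_(x <- msupp c) c@_x *: F x.

Section LinExt.
Variables (M : lmodType G) (F : I -> M).

Lemma linextEw c (D : {fset I}) : (msupp c `<=` D)%fset ->
  linext F c = \sum_(x <- D) c@_x *: F x.
Proof.
move=> cD; rewrite /linext (big_fset_incl _ cD) // => x xD.
by rewrite -mcoeff_eq0 => /eqP ->; rewrite scale0r.
Qed.

Lemma linext_is_linear : linear (linext F).
Proof.
move=> a c d; pose D := (msupp c `|` msupp d `|` msupp (a *: c + d))%fset.
have Dc : (msupp c `<=` D)%fset.
  by rewrite /D -fsetUA; apply: fsubsetUl.
have Dd : (msupp d `<=` D)%fset.
  by rewrite /D (fsetUC (msupp c)) -fsetUA; apply: fsubsetUl.
have Da : (msupp (a *: c + d) `<=` D)%fset by apply: fsubsetUr.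
rewrite (linextEw Dc) (linextEw Dd) (linextEw Da) scaler_sumr -big_split /=.
by apply: eq_bigr => x _; rewrite mcoeffD coefZ scalerA scalerDl.
Qed.

HB.instance Definition _ :=
  GRing.isLinear.Build G freeMod M _ (linext F) linext_is_linear.

Lemma linext_gen x : linext F (gen x) = F x.
Proof.
have le : (msupp (gen x) `<=` [fset x])%fset by exact: msuppU_le.
by rewrite (linextEw le) big_seq_fset1 coef_gen eqxx scale1r.
Qed.

End LinExt.

Lemma freeE c : c = \sum_(x <- msupp c) c@_x *: gen x.
Proof.
apply/malgP => y; rewrite {1}[c]monalgE !raddf_sum /=.
by apply: eq_bigr => x _; rewrite coefZ coef_gen mcoeffU mulr_natr.
Qed.

Lemma eq_linear (M : lmodType G) (f g : {linear freeMod -> M}) :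
  (forall x, f (gen x) = g (gen x)) -> f =1 g.
Proof.
move=> fg c; rewrite [c]freeE !linear_sum.
by apply: eq_bigr => x _; rewrite !linearZ /= fg.
Qed.

End FreeModule.

Section QuotientModule.
Variables (G : comPzRingType) (V : lmodType G) (S : submodClosed V).

Local Open Scope quotient_scope.

(* The library records only that a submodClosed predicate is closed under
   addition and scaling; quotients by it also need subtraction. *)
Definition quotIdeal : V -> bool := fun v => v \in S.

Fact quotIdeal_zmod_closed : zmod_closed quotIdeal.
Proof.
split=> [|u v uS vS]; first exact: rpred0.
by rewrite -scaleN1r; apply: rpredD uS _; apply: rpredZ.
Qed.

HB.instance Definition _ :=
  GRing.isZmodClosed.Build V quotIdeal quotIdeal_zmod_closed.

Definition quotMod := Quotient.quot (GRing.ZmodClosed.clone V quotIdeal _).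

HB.instance Definition _ := Choice.on quotMod.
HB.instance Definition _ := GRing.Zmodule.on quotMod.

Definition quotPi (v : V) : quotMod := \pi_(Quotient.quot (GRing.ZmodClosed.clone V quotIdeal _)) v.

Lemma quotPi_eq u v : (quotPi u = quotPi v) <-> (u - v \in S).
Proof.
have E : (u - v \in S) = (quotPi u == quotPi v).
  exact: (Quotient.idealrBE (GRing.ZmodClosed.clone V quotIdeal _) u v).
by rewrite E; split=> /eqP.
Qed.

Lemma quotPi_surj (q : quotMod) : exists v, q = quotPi v.
Proof. by exists (generic_quotient.repr q); rewrite /quotPi reprK. Qed.

Definition quotScale (a : G) (q : quotMod) : quotMod :=
  quotPi (a *: generic_quotient.repr q).

Lemma quotScaleE a v : quotScale a (quotPi v) = quotPi (a *: v).
Proof.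
apply/quotPi_eq; rewrite -scalerBr rpredZ //; apply/quotPi_eq.
by rewrite /quotPi reprK.
Qed.

Lemma quotPiD u v : quotPi (u + v) = quotPi u + quotPi v.
Proof. by rewrite /quotPi raddfD. Qed.

Lemma quotScaleA a b q : quotScale a (quotScale b q) = quotScale (a * b) q.
Proof.
by have [v ->] := quotPi_surj q; rewrite !quotScaleE scalerA.
Qed.

Lemma quotScale1 : left_id 1 quotScale.
Proof.
by move=> q; have [v ->] := quotPi_surj q; rewrite quotScaleE scale1r.
Qed.

Lemma quotScaleDr : right_distributive quotScale +%R.
Proof.
move=> a p q; have [u ->] := quotPi_surj p; have [v ->] := quotPi_surj q.
by rewrite -quotPiD !quotScaleE -quotPiD scalerDr.
Qed.

Lemma quotScaleDl q : {morph quotScale^~ q : a b / a + b}.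
Proof.
move=> a b; have [v ->] := quotPi_surj q.
by rewrite !quotScaleE -quotPiD scalerDl.
Qed.

HB.instance Definition _ := GRing.Zmodule_isLmodule.Build G quotMod
  quotScaleA quotScale1 quotScaleDr quotScaleDl.

Lemma quotPi_is_linear : linear quotPi.
Proof. by move=> a u v; rewrite quotPiD -quotScaleE. Qed.

HB.instance Definition _ :=
  GRing.isLinear.Build G V quotMod _ quotPi quotPi_is_linear.

End QuotientModule.

Section StandardSimplex.
Variable R : realType.

Definition stdsimplex (k : nat) : set 'rV[R]_k.+1 :=
  [set x | (forall i, 0 <= x ord0 i) /\ \sum_i x ord0 i = 1].
Arguments stdsimplex : clear implicits.

Definition face_row k (i : 'I_k.+2) (x : 'rV[R]_k.+1) : 'rV[R]_k.+2 :=
  \row_j (if unlift i j is Some j' then x ord0 j' else 0).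

Lemma face_rowP k (i : 'I_k.+2) (x : stdsimplex k) :
  face_row i (\val x) \in stdsimplex k.+1.
Proof.
have /set_mem[x0 x1] := valP x; apply/mem_set; split=> [j|].
  by rewrite mxE; case: (unlift i j).
rewrite (bigD1_ord i) //= mxE unlift_none add0r -[RHS]x1.
by apply: eq_bigr => j _; rewrite mxE liftK.
Qed.

(* The i-th face inclusion. *)
Definition face k (i : 'I_k.+2) (x : stdsimplex k) : stdsimplex k.+1 :=
  exist (fun y => y \in stdsimplex k.+1) _ (face_rowP i x).

Lemma face_row_continuous k (i : 'I_k.+2) : continuous (@face_row k i).
Proof.
move=> x A [P xP PA].
exists (fun a b => P a (lift i b)) => [a b|y yP].
  by have := xP a (lift i b); rewrite mxE liftK (ord1 a).
apply: PA => a j; rewrite mxE; case: unliftP => [j' ->|->].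
  by rewrite (ord1 a); exact: (yP ord0 j').
by have := xP a i; rewrite mxE unlift_none; exact: nbhs_singleton.
Qed.

Lemma face_continuous k (i : 'I_k.+2) : continuous (@face k i).
Proof.
apply: continuous_comp_initial => x.
apply: (@continuous_comp _ _ _ (\val : stdsimplex k -> _) (@face_row k i)).
  exact: initial_continuous.
exact: face_row_continuous.
Qed.

HB.instance Definition _ k (i : 'I_k.+2) :=
  @isContinuous.Build (stdsimplex k) (stdsimplex k.+1) (@face k i)
    (@face_continuous k i).

End StandardSimplex.
Arguments stdsimplex : clear implicits.

Section Singular.
Variables (R : realType) (G : comPzRingType).
Implicit Types X Y Z : topologicalType.

Definition singular k X := continuousType (stdsimplex R k) X.

HB.instance Definition _ k X := Choice.on (singular k X).

Definition schain k X := freeMod G (singular k X).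

HB.instance Definition _ k X := GRing.Lmodule.on (schain k X).

Definition sface k X (i : 'I_k.+2) (s : singular k.+1 X) : singular k X :=
  [the continuousType _ _ of s \o @face R k i].

Definition sboundary k X : schain k.+1 X -> schain k X :=
  linext (fun s => \sum_(i < k.+2) (-1) ^+ i *: gen G (sface i s)).

HB.instance Definition _ k X := GRing.Linear.on (@sboundary k X).

Definition saug X : schain 0 X -> G^o :=
  @linext G _ G^o (fun=> 1).

HB.instance Definition _ X := GRing.Linear.on (@saug X).

Definition carrier k X (c : schain k X) : set X :=
  \bigcup_(s in [set` msupp c]) range s.

(* Degree 0 uses the augmentation: homology is reduced. *)
Definition is_cycle k X : schain k X -> bool :=
  match k with
  | 0 => fun c => saug c == 0
  | k'.+1 => fun c => sboundary c == 0
  end.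

Fact is_cycle_submod k X : submod_closed (@is_cycle k X).
Proof.
case: k => [|k]; (split=> [|a c d]; rewrite !unfold_in /=).
- by rewrite linear0.
- by move=> /eqP c0 /eqP d0; rewrite linearP /= c0 d0 scaler0 addr0.
- by rewrite linear0.
- by move=> /eqP c0 /eqP d0; rewrite linearP /= c0 d0 scaler0 addr0.
Qed.

HB.instance Definition _ k X :=
  GRing.isSubmodClosed.Build G (schain k X) (@is_cycle k X)
    (is_cycle_submod k X).

Record cycles k X := Cycle {
  cycle_chain : schain k X;
  _ : cycle_chain \in @is_cycle k X
}.

HB.instance Definition _ k X := [isSub for @cycle_chain k X].
HB.instance Definition _ k X := [Choice of cycles k X by <:].
HB.instance Definition _ k X := [SubChoice_isSubLmodule of cycles k X by <:].

Definition is_boundary k X (z : cycles k X) : bool :=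
  `[< exists c : schain k.+1 X, sboundary c = \val z >].

Fact is_boundary_submod k X : submod_closed (@is_boundary k X).
Proof.
split=> [|a u v /asboolP[c cu] /asboolP[d dv]]; apply/asboolP.
  by exists 0; rewrite !linear0.
by exists (a *: c + d); rewrite !linearP /= cu dv.
Qed.

HB.instance Definition _ k X :=
  GRing.isSubmodClosed.Build G (cycles k X) (@is_boundary k X)
    (is_boundary_submod k X).

Definition homology k X :=
  quotMod (GRing.SubmodClosed.clone G (cycles k X) (@is_boundary k X) _).

HB.instance Definition _ k X := GRing.Lmodule.on (homology k X).

Definition homology_class k X : cycles k X -> homology k X := @quotPi _ _ _.

HB.instance Definition _ k X := GRing.Linear.on (@homology_class k X).

Lemma homology_class_eq k X (u v : cycles k X) :
  homology_class u = homology_class v <->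
  exists c : schain k.+1 X, sboundary c = \val u - \val v.
Proof.
split=> [/quotPi_eq/asboolP//|[c cuv]].
by apply/quotPi_eq/asboolP; exists c.
Qed.

Lemma homology_class_surj k X (h : homology k X) :
  exists z, h = homology_class z.
Proof. exact: quotPi_surj. Qed.

Section Functoriality.
Variables (X Y : topologicalType) (f : continuousType X Y).

Definition spush k (s : singular k X) : singular k Y :=
  [the continuousType _ _ of f \o s].

Definition chain_map k : schain k X -> schain k Y :=
  linext (fun s => gen G (spush s)).

HB.instance Definition _ k := GRing.Linear.on (@chain_map k).

Lemma sboundary_chain_map k (c : schain k.+1 X) :
  sboundary (chain_map c) = chain_map (sboundary c).
Proof.
move: c; apply: (@eq_linear _ _ _
  (@sboundary k Y \o @chain_map k.+1) (@chain_map k \o @sboundary k X)) => s.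
rewrite /= /chain_map /sboundary !linext_gen linear_sum.
apply: eq_bigr => i _; rewrite linearZ /= linext_gen; congr (_ *: gen G _).
exact/continuousEP.
Qed.

Lemma saug_chain_map (c : schain 0 X) : saug (chain_map c) = saug c.
Proof.
move: c; apply: (@eq_linear _ _ _ (@saug Y \o @chain_map 0) (@saug X)) => s.
by rewrite /= /chain_map /saug !linext_gen.
Qed.

Lemma chain_map_cycle k (z : cycles k X) :
  chain_map (\val z) \in @is_cycle k Y.
Proof.
case: k z => [|k] [c /= cP]; move: cP; rewrite !unfold_in /=.
  by rewrite saug_chain_map.
by rewrite sboundary_chain_map => /eqP ->; rewrite linear0.
Qed.

Definition cycle_map k (z : cycles k X) : cycles k Y :=
  Cycle (chain_map_cycle z).

Definition homology_map k (h : homology k X) : homology k Y :=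
  homology_class (cycle_map (generic_quotient.repr h)).

Lemma homology_mapE k (z : cycles k X) :
  homology_map (homology_class z) = homology_class (cycle_map z).
Proof.
apply/homology_class_eq.
have /homology_class_eq[c cz] :
    homology_class (generic_quotient.repr (homology_class z)) =
    homology_class z.
  by rewrite [LHS]reprK.
exists (chain_map c); rewrite sboundary_chain_map cz.
by rewrite linearB.
Qed.

Fact homology_map_is_linear k : linear (@homology_map k).
Proof.
move=> a p q; have [u ->] := homology_class_surj p.
have [v ->] := homology_class_surj q; rewrite -linearP !homology_mapE -linearP; congr homology_class.
by apply/val_inj; rewrite /= !linearP.
Qed.

HB.instance Definition _ k :=
  GRing.isLinear.Build G (homology k X) (homology k Y) _ (@homology_map k)
    (@homology_map_is_linear k).

End Functoriality.

End Singular.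

Section Oriented.
Variables (G : comPzRingType) (T : choiceType).

Record complex := Complex {
  simplices :> {fset T} -> Prop;
  simplex_neq0 : forall s, simplices s -> s != fset0;
  simplex_face : forall s t,
    simplices s -> (t `<=` s)%fset -> t != fset0 -> simplices t
}.

Definition has_dim (K : complex) (d : nat) : Prop :=
  (exists2 s, K s & #|` s| = d.+1) /\ (forall s, K s -> (#|` s| <= d.+1)%N).

Definition vtuple k := {ffun 'I_k.+1 -> T}.

Definition vset k (t : vtuple k) : {fset T} := [fset t i | i in 'I_k.+1]%fset.

Definition vperm k (p : 'S_k.+1) (t : vtuple k) : vtuple k :=
  [ffun i => t (p i)].

Definition vdrop k (i : 'I_k.+2) (t : vtuple k.+1) : vtuple k :=
  [ffun j => t (lift i j)].

Lemma vperm1 k : vperm 1 =1 (id : vtuple k -> _).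
Proof. by move=> t; apply/ffunP => i; rewrite ffunE perm1. Qed.

Lemma vpermM k (p q : 'S_k.+1) (t : vtuple k) :
  vperm p (vperm q t) = vperm (p * q) t.
Proof. by apply/ffunP => i; rewrite !ffunE permM. Qed.

Lemma vperm_inj k (p : 'S_k.+1) : injective (@vperm k p).
Proof.
move=> t u /(congr1 (vperm p^-1)).
by rewrite !vpermM mulVg !vperm1.
Qed.

Lemma vdrop_lift k (i : 'I_k.+2) (j : 'I_k.+2) (p : 'S_k.+1) (t : vtuple k.+1) :
  vdrop i (vperm (lift_perm i j p) t) = vperm p (vdrop j t).
Proof. by apply/ffunP => a; rewrite !ffunE lift_perm_lift. Qed.

Lemma in_vset k (t : vtuple k) x : reflect (exists i, t i = x) (x \in vset t).
Proof.
apply: (iffP idP) => [/imfsetP[i _ ->]|[i <-]]; first by exists i.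
by apply/imfsetP; exists i.
Qed.

Lemma vset_neq0 k (t : vtuple k) : vset t != fset0.
Proof.
by apply/fset0Pn; exists (t ord0); apply/in_vset; exists ord0.
Qed.

Definition ordered_simplex (K : complex) k (t : vtuple k) : Prop :=
  injective t /\ K (vset t).

Lemma vdrop_ordered (K : complex) k (i : 'I_k.+2) (t : vtuple k.+1) :
  ordered_simplex K t -> ordered_simplex K (vdrop i t).
Proof.
move=> [ti tK]; split=> [a b|]; first by rewrite !ffunE => /ti /lift_inj.
apply: simplex_face tK _ (vset_neq0 _); apply/fsubsetP => x /in_vset[j <-].
by apply/in_vset; exists (lift i j); rewrite ffunE.
Qed.

Lemma vset_vperm k (p : 'S_k.+1) (t : vtuple k) : vset (vperm p t) = vset t.
Proof.
apply/fsetP => x; apply/in_vset/in_vset => -[i <-].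
  by exists (p i); rewrite ffunE.
by exists ((p^-1)%g i); rewrite ffunE permKV.
Qed.

(* An oriented k-chain is a finitely supported function on the ordered
   k-simplices (v_0, ..., v_k) of K that is multiplied by the sign of p when
   the vertices are permuted by p; equivalently, a function c on oriented
   simplices such that c takes opposite values on opposite orientations. *)
Definition is_ochain (K : complex) k (c : freeMod G (vtuple k)) : bool :=
  `[< (forall p t, c@_(vperm p t) = (-1) ^+ p * c@_t) /\
      (forall t, c@_t != 0 -> ordered_simplex K t) >].

Fact is_ochain_submod K k : submod_closed (@is_ochain K k).
Proof.
split=> [|a c d /asboolP[cp cK] /asboolP[dp dK]]; apply/asboolP; split.
- by move=> p t; rewrite !mcoeff0 mulr0.
- by move=> t; rewrite mcoeff0 eqxx.
- move=> p t; rewrite !mcoeffD !coefZ cp dp mulrDr; congr (_ + _).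
  by rewrite mulrCA.
- move=> t; rewrite mcoeffD coefZ.
  have [c0|/cK//] := eqVneq (c@_t) 0.
  have [d0|/dK//] := eqVneq (d@_t) 0.
  by rewrite c0 d0 mulr0 addr0 eqxx.
Qed.

HB.instance Definition _ K k :=
  GRing.isSubmodClosed.Build G (freeMod G (vtuple k)) (@is_ochain K k)
    (is_ochain_submod K k).

Record ochain (K : complex) k := OChain {
  ochain_val : freeMod G (vtuple k);
  _ : ochain_val \in @is_ochain K k
}.

HB.instance Definition _ K k := [isSub for @ochain_val K k].
HB.instance Definition _ K k := [Choice of ochain K k by <:].
HB.instance Definition _ K k := [SubChoice_isSubLmodule of ochain K k by <:].

Definition oact k (p : 'S_k.+1) : freeMod G (vtuple k) -> freeMod G (vtuple k) :=
  linext (fun t => gen G (vperm p t)).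

HB.instance Definition _ k p := GRing.Linear.on (@oact k p).

Lemma coef_oact k p (c : freeMod G (vtuple k)) t :
  (oact p c)@_(vperm p t) = c@_t.
Proof.
rewrite {2}(freeE c) /oact /linext !raddf_sum /=; apply: eq_bigr => u _.
by rewrite !coefZ !coef_gen (inj_eq (@vperm_inj k p)).
Qed.

Lemma oact_ochain K k p (c : ochain K k) :
  oact p (\val c) = (-1) ^+ p *: \val c.
Proof.
case: c => c /= /asboolP[cp _]; apply/malgP => t.
have -> : t = vperm p (vperm p^-1 t) by rewrite vpermM mulgV vperm1.
move: (vperm p^-1 t) => u.
by rewrite coef_oact coefZ cp mulrA -signr_addb addbb mul1r.
Qed.

Lemma is_ochainP K k (c : freeMod G (vtuple k)) :
  (forall p, oact p c = (-1) ^+ p *: c) ->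
  (forall t, c@_t != 0 -> ordered_simplex K t) -> c \in @is_ochain K k.
Proof.
move=> cp cK; apply/asboolP; split=> // p t.
by rewrite -[in RHS](coef_oact p) cp coefZ mulrA -signr_addb addbb mul1r.
Qed.

(* The value of the boundary of c at (v_0, ..., v_k) is the sum over all
   vertices v of c (v, v_0, ..., v_k); oboundary_elementary below is the usual
   formula on elementary chains. *)
Definition otail k : freeMod G (vtuple k.+1) -> freeMod G (vtuple k) :=
  linext (fun t => gen G (vdrop ord0 t)).

HB.instance Definition _ k := GRing.Linear.on (@otail k).

Lemma otail_oact k (p : 'S_k.+1) (c : freeMod G (vtuple k.+1)) :
  oact p (otail c) = otail (oact (lift_perm ord0 ord0 p) c).
Proof.
move: c; apply: (@eq_linear _ _ _ (oact p \o @otail k)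
  (@otail k \o oact (lift_perm ord0 ord0 p))) => t.
by rewrite /= /oact /otail !linext_gen vdrop_lift.
Qed.

Lemma otail_ochain K k (c : ochain K k.+1) :
  otail (\val c) \in @is_ochain K k.
Proof.
apply: is_ochainP => [p|t].
  by rewrite otail_oact oact_ochain linearZ /= odd_lift_perm.
case: c => c /= /asboolP[_ cK]; rewrite /otail /linext raddf_sum /= => ct.
have [/eqP c0|] := boolP (has (fun u => vdrop ord0 u == t) (msupp c)); last first.
  move=> /hasPn ut; case/negP: ct; apply/eqP/big1_seq => u /andP[_ /ut] uct.
  by rewrite coefZ coef_gen (negPf uct) mulr0.
move/eqP/hasP : c0 => [u uc /eqP <-]; apply/vdrop_ordered/cK.
by rewrite mcoeff_neq0.
Qed.

Definition oboundary K k (c : ochain K k.+1) : ochain K k :=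
  OChain (otail_ochain c).

Fact oboundary_is_linear K k : linear (@oboundary K k).
Proof. by move=> a c d; apply/val_inj; rewrite /= linearP. Qed.

HB.instance Definition _ K k :=
  GRing.isLinear.Build G (ochain K k.+1) (ochain K k) _ (@oboundary K k)
    (@oboundary_is_linear K k).

Definition oaug K (c : ochain K 0) : G^o :=
  @linext G _ G^o (fun=> 1) (\val c).

Fact oaug_is_linear K : linear (@oaug K).
Proof. by move=> a c d; rewrite /oaug !linearP. Qed.

HB.instance Definition _ K :=
  GRing.isLinear.Build G (ochain K 0) G^o _ (@oaug K) (@oaug_is_linear K).

(* The elementary chain [v_0, ..., v_k]. *)
Definition alt k (t : vtuple k) : freeMod G (vtuple k) :=
  \sum_(p : 'S_k.+1) (-1) ^+ p *: gen G (vperm p t).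

Lemma oact_alt k p (t : vtuple k) : oact p (alt t) = (-1) ^+ p *: alt t.
Proof.
rewrite /alt linear_sum scaler_sumr (reindex_inj (mulgI p^-1%g)) /=.
apply: eq_bigr => q _; rewrite linearZ /= /oact linext_gen vpermM.
by rewrite mulKVg scalerA odd_permM signr_addb odd_permV.
Qed.

Lemma alt_ochain (K : complex) k (t : vtuple k) :
  ordered_simplex K t -> alt t \in @is_ochain K k.
Proof.
move=> [ti tK]; apply: is_ochainP => [p|u]; first exact: oact_alt.
rewrite /alt raddf_sum /= => tu.
have [/existsP[p /eqP <-]|/existsPn pu] := boolP [exists p, vperm p t == u].
  by split=> [i j|]; [rewrite !ffunE => /ti /perm_inj|rewrite vset_vperm].
case/negP: tu; apply/eqP/big1 => p _.
by rewrite coefZ coef_gen (negPf (pu p)) mulr0.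
Qed.

Definition elementary (K : complex) k (t : vtuple k)
    (tK : ordered_simplex K t) : ochain K k := OChain (alt_ochain tK).

Lemma oboundary_elementary (K : complex) k (t : vtuple k.+1)
    (tK : ordered_simplex K t) :
  oboundary (elementary tK) =
  \sum_(i < k.+2) (-1) ^+ i *: elementary (vdrop_ordered i tK).
Proof.
apply/val_inj; rewrite raddf_sum /= /alt linear_sum /=.
rewrite (partition_big (fun p : 'S_k.+2 => p ord0) xpredT) //=.
apply: eq_bigr => i _; rewrite scaler_sumr.
rewrite (reindex (lift_perm ord0 i)); last first.
  pose ulsf i (s : 'S_k.+2) k := odflt k (unlift (s i) (s (lift i k))).
  have ulsfK i' (s : 'S_k.+2) k' : lift (s i') (ulsf i' s k') = s (lift i' k').
    rewrite /ulsf; have:= neq_lift i' k'.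
    by rewrite -(can_eq (permK s)) => /unlift_some[] ? ? ->.
  have inj_ulsf : injective (ulsf ord0 _).
    move=> s; apply: can_inj (ulsf (s ord0) s^-1%g) _ => k'.
    by rewrite {1}/ulsf ulsfK !permK liftK.
  exists (fun s => perm (inj_ulsf s)) => [s _ | s].
    by apply/permP=> k'; rewrite permE /ulsf lift_perm_lift lift_perm_id liftK.
  move/(s _ =P _) => si0; apply/permP=> k'.
  case: (unliftP ord0 k') => [k''|] ->; rewrite ?lift_perm_id //.
  by rewrite lift_perm_lift -si0 permE ulsfK.
apply: eq_big => [p|p _]; first by rewrite lift_perm_id eqxx.
rewrite linearZ /= /otail linext_gen vdrop_lift scalerA odd_lift_perm /=.
by rewrite !signr_addb signr_odd.
Qed.

Lemma oaug_elementary (K : complex) (t : vtuple 0) (tK : ordered_simplex K t) :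
  oaug (elementary tK) = 1.
Proof.
rewrite /oaug /= /alt (big_pred1 1%g) => [|p].
  by rewrite odd_perm1 scale1r linext_gen.
by apply/esym/eqP/permP => i; rewrite !ord1.
Qed.

End Oriented.

Section Realizations.
Variables (R : realType) (G : comPzRingType) (T : choiceType).
Variable X : topologicalType.
Implicit Types (K L : complex T) (W : set (set X)).

Record chain_morphism L := ChainMorphism {
  morphism_map :> forall k, {linear ochain G L k -> schain R G k X};
  morphism_boundary : forall k (c : ochain G L k.+1),
    sboundary (morphism_map k.+1 c) = morphism_map k (oboundary c);
  morphism_aug : forall c : ochain G L 0, saug (morphism_map 0 c) = oaug c
}.

Definition subcomplex L K : Prop := forall s, L s -> K s.

Definition contains_vertices L K : Prop :=
  forall v, K [fset v]%fset -> L [fset v]%fset.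

(* Orderings t of the same simplex tau give the same carrier, as [t] is
   determined by tau up to sign. *)
Definition partial_realization W K L (phi : chain_morphism L) : Prop :=
  [/\ subcomplex L K, contains_vertices L K &
      forall s, K s -> exists2 A, W A &
        forall k (t : vtuple T k) (tL : ordered_simplex L t),
          (vset t `<=` s)%fset -> carrier (phi k (elementary G tL)) `<=` A].

Definition full_realization W K (phi : chain_morphism K) : Prop :=
  partial_realization W K phi.

Definition correct L (phi : chain_morphism L) : Prop :=
  forall (t : vtuple T 0) (tL : ordered_simplex L t),
    exists s : singular R 0 X, phi 0 (elementary G tL) = gen G s.

(* C(L; G) sits in C(K; G) as the chains supported on L. *)
Definition extends K L (psi : chain_morphism K) (phi : chain_morphism L) :
    Prop :=
  forall k (c : ochain G L k) (c' : ochain G K k),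
    \val c' = \val c -> psi k c' = phi k c.

End Realizations.

Section Topology.
Implicit Types X Y : topologicalType.

Definition open_cover X (U : set (set X)) : Prop :=
  (forall A, U A -> open A) /\ \bigcup_(A in U) A = setT.

Definition refines X (V U : set (set X)) : Prop :=
  forall A, V A -> exists2 B, U B & A `<=` B.

Definition locally_finite X (V : set (set X)) : Prop :=
  forall x : X, exists2 N, nbhs x N & finite_set [set A | V A /\ A `&` N !=set0].

Definition paracompact X : Prop :=
  hausdorff_space X /\
  forall U : set (set X), open_cover U ->
    exists V, [/\ open_cover V, refines V U & locally_finite V].

Definition closed_map X Y (f : X -> Y) : Prop :=
  forall A, closed A -> closed (f @` A).

Definition preimage_cover X Y (f : X -> Y) (V : set (set Y)) : set (set X) :=
  [set f @^-1` A | A in V].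

Definition set_incl X (V U : set X) (VU : V `<=` U) (x : V) : U :=
  exist (fun y => y \in U) (\val x) (mem_set (VU _ (set_mem (valP x)))).

Fact set_incl_continuous X (V U : set X) (VU : V `<=` U) :
  continuous (set_incl VU).
Proof. by apply: continuous_comp_initial; exact: initial_continuous. Qed.

HB.instance Definition _ X (V U : set X) (VU : V `<=` U) :=
  @isContinuous.Build V U (set_incl VU)
    (@set_incl_continuous X V U VU).

Variables (R : realType) (G : comPzRingType).

Definition homologically_UV (n : nat) X (A : set X) : Prop :=
  closed A /\
  forall U : set X, set_nbhs A U ->
    exists2 V : set X, set_nbhs A V &
      exists VU : V `<=` U, forall k, (k <= n)%N ->
        forall h : homology R G k V, homology_map (set_incl VU) h = 0.

Definition homologically_UV_map (n : nat) X Y (f : X -> Y) : Prop :=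
  (forall y, exists x, f x = y) /\
  forall y, homologically_UV n (f @^-1` [set y]).

End Topology.

(* Main.v *)
(* Members of the required cover V are open sets O whose preimage is so small
   that every cycle of dimension at most n in f^-1(O) bounds in f^-1(B), where O
   lies in B and B runs over an open star refinement of U; such O exist because f
   is closed with homologically UV^n fibres.  If phi is defined on all proper
   faces of a simplex t, its value on the boundary of t is a cycle in some
   f^-1(O_t), and a chain in f^-1(B_t) bounded by it is the value of the extension at
   t.  For a simplex s containing t, the sets B_t and B_s both contain the image
   of a vertex of t, so all the B_t lie in the star of B_s, hence in one member
   of U.  This raises the dimension by one; n + 1 rounds reach dimension n + 1. *)

From HB Require Import structures.
From mathcomp Require Import all_boot all_fingroup all_algebra finmap.
From mathcomp Require Import monalg.
From mathcomp Require Import all_classical all_reals.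
From mathcomp Require Import topology.
Require Import Defs.

Set Implicit Arguments.
Unset Strict Implicit.
Unset Printing Implicit Defensive.

Import GRing.Theory Num.Theory.
Import numFieldTopology.Exports.

Local Open Scope classical_set_scope.
Local Open Scope ring_scope.

(** * Star refinements in paracompact spaces *)

Section StarRefinement.
Variable Y : topologicalType.
Implicit Types (U V : set (set Y)) (A B : set Y).

Definition star V A : set Y := \bigcup_(B in [set B | V B /\ B `&` A !=set0]) B.

Lemma nbhs_setC x A : nbhs x (~` A) <-> ~ closure A x.
Proof. by rewrite -[nbhs x _]/((~` A)° x) interiorC. Qed.

(** Only finitely many members of [V] meet a suitable neighbourhood [N] of [x], and these contribute
    a finite intersection. A member that misses [N] does not have [x] in its closure, so [h A]
    contains its complement and hence [N]. *)
Lemma locally_finite_nbhs V (h : set Y -> set Y) x :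
  locally_finite V ->
  (forall A, V A -> nbhs x (h A)) ->
  (forall A, V A -> closure A x \/ ~` A `<=` h A) ->
  nbhs x (\bigcap_(A in V) h A).
Proof.
move=> /(_ x)[N Nx fin] hx cl.
have : nbhs x (N `&` \bigcap_(A in [set A | V A /\ A `&` N !=set0]) h A).
  apply: filterI => //; move/finite_fsetP: fin => [D DE]; rewrite DE.
  apply: filter_bigI => A AD.
  by move: AD; rewrite -[X in X -> _]/([set` D] A) -DE => -[VA _]; exact: hx.
apply: filterS => y [Ny hy] A VA.
have [AN|AN] := pselect (A `&` N !=set0); first exact: hy.
have [/(_ N Nx)//|] := cl A VA.
by apply=> Ay; apply: AN; exists y.
Qed.

Lemma open_cover_nbhs (W : Y -> set Y) : (forall x, nbhs x (W x)) ->
  open_cover [set (W x)° | x in setT].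
Proof.
move=> Wx; split=> [_ [x _ <-]|]; first exact: open_interior.
by rewrite -subTset => y _; exists (W y)°; [exists y|exact: Wx].
Qed.

Lemma cover_ex U y : open_cover U -> exists2 A, U A & A y.
Proof. by case=> _ UT; have : setT y by []; rewrite -UT => -[A]; exists A. Qed.

(** Points outside [O] have open neighbourhoods whose closures miss [x]. In a locally finite
    refinement, the members whose closures miss [x] have an open union [D] that covers the
    complement of [O]; local finiteness makes the closed complement of [D] a neighbourhood of
    [x]. *)
Lemma paracompact_regular A (x : Y) : paracompact Y -> nbhs x A ->
  exists2 B, nbhs x B & closure B `<=` A.
Proof.
move=> [hY pY] xA; have := xA; rewrite {1}nbhsE => -[O [Oo Ox] OA] {xA}.
have sep y : exists P, [/\ open P, P y & P `<=` O \/ ~ closure P x].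
  have [Oy|Oy] := pselect (O y); first by exists O; split => //; left.
  have xy : x != y by apply/eqP => xy; apply: Oy; rewrite -xy.
  move: hY; rewrite open_hausdorff => /(_ x y xy)[[P Q] /=].
  move=> [/set_mem Px /set_mem Qy].
  move=> [Po Qo /eqP PQ0]; exists Q; split=> //; right.
  apply/nbhs_setC; rewrite nbhsE; exists P => // z Pz Qz.
  by have : set0 z by rewrite -PQ0.
have [P /all_and3[Po Py Psep]] := choice sep.
have coverP : open_cover (range P).
  split=> [_ [y _ <-]//|]; rewrite -subTset => y _.
  by exists (P y) => //; exists y.
have [V [coverV VP lfV]] := pY _ coverP.
pose D := \bigcup_(B in [set B | V B /\ ~ closure B x]) B.
have openD : open D by apply: bigcup_open => B [VB _]; case: coverV => + _; apply.
exists (~` D).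
  have lf' : locally_finite [set B | V B /\ ~ closure B x].
    move=> y; have [N Ny fin] := lfV y; exists N => //.
    by apply: sub_finite_set fin => B [[VB _] BN].
  rewrite /D setC_bigcup; apply: (locally_finite_nbhs (h := setC) lf') => B [VB clB].
    exact/nbhs_setC.
  by right.
rewrite closure_setC => y Dy; apply: OA; apply: contrapT => Oy; apply: Dy.
apply: open_nbhs_nbhs; split=> //.
have [B VB By] := cover_ex y coverV.
exists B => //; split=> //.
have [_ [z _ <-] BPz] := VP B VB.
by case: (Psep z) => [PO|Pcl /(closure_subset BPz)//]; case: Oy; apply/PO/BPz.
Qed.

(** For a locally finite [V], each [C] in [V] gets a member [a C] of [U] containing its closure. The
    set attached to [x] is cut out by [a C] if [x] is in the closure of [C], and by the complement
    of [C] otherwise. If it contains a point of [C], the first case must hold, so it lies in [a C],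
    whatever [x] is. *)
Lemma barycentric_refinement U : paracompact Y -> open_cover U ->
  exists2 W, open_cover W &
    forall y, exists2 A, U A & forall B, W B -> B y -> B `<=` A.
Proof.
move=> pY coverU.
have ex (x : Y) : exists B, nbhs x B /\ exists2 A, U A & closure B `<=` A.
  have [A UA Ax] := cover_ex x coverU.
  have [B Bx BA] : exists2 B, nbhs x B & closure B `<=` A.
    apply: paracompact_regular => //; apply: open_nbhs_nbhs; split=> //.
    by case: coverU => + _; apply.
  by exists B; split=> //; exists A.
have [B /all_and2[Bx BU]] := choice ex.
have [V [coverV VB lfV]] := pY.2 _ (open_cover_nbhs Bx).
have VU C : exists A, V C -> U A /\ closure C `<=` A.
  have [VC|] := pselect (V C); last by move=> nVC; exists set0.
  have [_ [x _ <-] CB] := VB C VC; have [A UA BA] := BU x.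
  exists A => _; split=> //; apply: subset_trans BA.
  by apply: closure_subset; apply: subset_trans CB (@interior_subset _ _).
have [a VUa] := choice VU.
pose h x C := if `[< closure C x >] then a C else ~` C.
have Wx (x : Y) : nbhs x (\bigcap_(C in V) h x C).
  apply: (locally_finite_nbhs (h := h x) lfV) => C VC; rewrite /h.
    case: asboolP => [Cx|/nbhs_setC//].
    have [UaC CaC] := VUa C VC; apply: open_nbhs_nbhs.
    by split; [case: coverU => + _; apply|exact: CaC].
  by case: asboolP; [left|right].
exists [set (\bigcap_(C in V) h x C)° | x in setT]; first exact: open_cover_nbhs.
move=> y; have [C VC Cy] := cover_ex y coverV.
exists (a C) => [|_ [x _ <-] Wy]; first by case: (VUa C VC).
move: Wy => /interior_subset/(_ C VC) hy z /interior_subset/(_ C VC).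
by move: hy; rewrite /h; case: asboolP.
Qed.

(** Refine barycentrically twice. If [C] meets [B] in [w], then [B] and [C] lie in one member [D] of
    [V]; every such [D] contains the fixed point [y] of [B], so all of them lie in one member of
    [U]. *)
Lemma star_refinement U : paracompact Y -> open_cover U ->
  exists2 W, open_cover W &
    forall B, W B -> B !=set0 -> exists2 A, U A & star W B `<=` A.
Proof.
move=> pY coverU.
have [V coverV VU] := barycentric_refinement pY coverU.
have [W coverW WV] := barycentric_refinement pY coverV.
exists W => // B WB [y By].
have [A UA VA] := VU y; exists A => // z [C [WC [w [Cw Bw]]] Cz].
have [D VD WD] := WV w.
by apply: (VA D) => //; [exact: (WD B)|exact: (WD C)].
Qed.

End StarRefinement.

(** * Carriers and chains in subspaces *)

Section Carriers.
Variables (R : realType) (G : comPzRingType) (X : topologicalType).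

Lemma carrier_subP k (c : schain R G k X) (B : set X) :
  carrier c `<=` B <-> forall s, c@_s != 0 -> range s `<=` B.
Proof.
split=> [cB s cs x sx|cB x [s cs sx]]; last by apply: (cB s) sx; rewrite mcoeff_neq0.
by apply: cB; exists s => //=; rewrite -mcoeff_neq0.
Qed.

Lemma carrier0 k (B : set X) : carrier (0 : schain R G k X) `<=` B.
Proof. by apply/carrier_subP => s; rewrite mcoeff0 eqxx. Qed.

Lemma carrierD k (c d : schain R G k X) (B : set X) :
  carrier c `<=` B -> carrier d `<=` B -> carrier (c + d) `<=` B.
Proof.
move=> /carrier_subP cB /carrier_subP dB; apply/carrier_subP => s.
rewrite mcoeffD; have [->|/cB//] := eqVneq (c@_s) 0.
by rewrite add0r => /dB.
Qed.

Lemma carrierZ k a (c : schain R G k X) (B : set X) :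
  carrier c `<=` B -> carrier (a *: c) `<=` B.
Proof.
move=> /carrier_subP cB; apply/carrier_subP => s.
rewrite (_ : (a *: c)@_s = a * c@_s); last exact: coefZ.
by have [->|/cB//] := eqVneq (c@_s) 0; rewrite mulr0 eqxx.
Qed.

Lemma carrier_sum k (I : eqType) (r : seq I) (P : pred I)
    (F : I -> schain R G k X) (B : set X) :
  (forall i, P i -> carrier (F i) `<=` B) ->
  carrier (\sum_(i <- r | P i) F i) `<=` B.
Proof.
move=> FB; elim/big_rec: _ => [|i c Pi cB]; first exact: carrier0.
by apply: carrierD => //; apply: FB.
Qed.

Lemma carrier_gen k (s : singular R k X) (B : set X) :
  range s `<=` B -> carrier (gen G s) `<=` B.
Proof.
move=> sB; apply/carrier_subP => t; rewrite coef_gen.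
by case: (s =P t) => [<- //|_]; rewrite eqxx.
Qed.

Lemma eq_linear_carrier k (B : set X) (M : lmodType G)
    (g h : {linear schain R G k X -> M}) c :
  (forall s : singular R k X, range s `<=` B -> g (gen G s) = h (gen G s)) ->
  carrier c `<=` B -> g c = h c.
Proof.
move=> gh /carrier_subP cB; rewrite [c]freeE !linear_sum.
rewrite !big_seq; apply: eq_bigr => s; rewrite -mcoeff_neq0 => /cB/gh gh_s.
by rewrite !linearZ /= gh_s.
Qed.

End Carriers.

Section Subspace.
Variables (R : realType) (G : comPzRingType) (X : topologicalType).
Implicit Types (V U : set X).

Definition sub_incl V (x : V) : X := \val x.

Fact sub_incl_continuous V : continuous (@sub_incl V).
Proof. exact: initial_continuous. Qed.

HB.instance Definition _ V :=
  @isContinuous.Build V X (@sub_incl V) (@sub_incl_continuous V).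

Definition slift_fun V k (s : singular R k X) (sV : range s `<=` V)
    (x : stdsimplex R k) : V :=
  exist (fun y => y \in V) (s x) (mem_set (sV _ (imageT s x))).

Fact slift_continuous V k (s : singular R k X) (sV : range s `<=` V) :
  continuous (slift_fun sV).
Proof. by apply: continuous_comp_initial; exact: cts_fun. Qed.

HB.instance Definition _ V k (s : singular R k X) (sV : range s `<=` V) :=
  @isContinuous.Build (stdsimplex R k) V (slift_fun sV) (@slift_continuous V k s sV).

Definition slift V k (s : singular R k X) (sV : range s `<=` V) :
  singular R k V := [the continuousType _ _ of slift_fun sV].

(** Sending simplices that leave [V] to 0 makes the lift linear on all chains of [X]; on chains
    carried by [V] it is a section of the inclusion. *)
Definition chain_lift V k : schain R G k X -> schain R G k V :=
  linext (fun s : singular R k X =>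
    if pselect (range s `<=` V) is left sV then gen G (slift sV) else 0).

HB.instance Definition _ V k := GRing.Linear.on (@chain_lift V k).

Lemma chain_lift_gen V k (s : singular R k X) (sV : range s `<=` V) :
  chain_lift V (gen G s) = gen G (slift sV).
Proof.
rewrite /chain_lift linext_gen; case: pselect => // sV'.
by congr (gen _ (slift _)); exact: Prop_irrelevance.
Qed.

Lemma chain_liftK V k (c : schain R G k X) : carrier c `<=` V ->
  chain_map [the continuousType _ _ of @sub_incl V] (chain_lift V c) = c.
Proof.
apply: (@eq_linear_carrier R G X k V (schain R G k X)
  (@chain_map R G _ _ [the continuousType _ _ of @sub_incl V] k
     \o @chain_lift V k) idfun) => s sV.
rewrite /= chain_lift_gen /chain_map linext_gen; congr gen.
exact/continuousEP.
Qed.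

Lemma sboundary_chain_lift V k (c : schain R G k.+1 X) : carrier c `<=` V ->
  sboundary (chain_lift V c) = chain_lift V (sboundary c).
Proof.
apply: (@eq_linear_carrier R G X k.+1 V (schain R G k V)
  (@sboundary R G k V \o @chain_lift V k.+1)
  (@chain_lift V k \o @sboundary R G k X)) => s sV.
rewrite /= chain_lift_gen /sboundary !linext_gen linear_sum.
apply: eq_bigr => i _; rewrite linearZ /=; congr (_ *: _).
have fV : range (sface i s) `<=` V.
  by move=> _ [x _ <-]; apply: sV; exists (face i x).
rewrite chain_lift_gen; congr gen; apply/continuousEP => x.
exact/val_inj.
Qed.

Lemma saug_chain_lift V (c : schain R G 0 X) : carrier c `<=` V ->
  saug (chain_lift V c) = saug c.
Proof.
apply: (@eq_linear_carrier R G X 0 V G^o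
  (@saug R G V \o @chain_lift V 0) (@saug R G X)) => s sV.
by rewrite /= chain_lift_gen /saug !linext_gen.
Qed.

Lemma chain_lift_cycle V k (c : schain R G k X) : carrier c `<=` V ->
  c \in @is_cycle R G k X -> chain_lift V c \in @is_cycle R G k V.
Proof.
case: k c => [|k] c cV; rewrite !unfold_in /=; first by rewrite saug_chain_lift.
by rewrite sboundary_chain_lift // => /eqP ->; rewrite linear0.
Qed.

Lemma chain_map_set_incl V U (VU : V `<=` U) k (c : schain R G k V) :
  chain_map [the continuousType _ _ of @sub_incl U]
    (chain_map [the continuousType _ _ of set_incl VU] c) =
  chain_map [the continuousType _ _ of @sub_incl V] c.
Proof.
move: c; apply: (@eq_linear _ _ _
  (@chain_map R G _ _ [the continuousType _ _ of @sub_incl U] k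
     \o @chain_map R G _ _ [the continuousType _ _ of set_incl VU] k)
  (@chain_map R G _ _ [the continuousType _ _ of @sub_incl V] k)) => s.
by rewrite /= /chain_map !linext_gen; congr gen; exact/continuousEP.
Qed.

Lemma carrier_chain_map U k (c : schain R G k U) :
  carrier (chain_map [the continuousType _ _ of @sub_incl U] c) `<=` U.
Proof.
apply: carrier_sum => s _; apply: carrierZ; apply: carrier_gen => _ [x _ <-].
exact/set_mem/valP.
Qed.

(** Homology of subspaces is traded for chains of [X] with small carriers: lift the cycle to [V],
    bound it in [U], and push the bounding chain into [X]. *)
Lemma UV_cycle_boundary n (A U : set X) :
  homologically_UV R G n A -> set_nbhs A U ->
  exists2 V : set X, set_nbhs A V &
    forall k (c : schain R G k X), (k <= n)%N -> c \in @is_cycle R G k X ->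
      carrier c `<=` V ->
      exists2 d : schain R G k.+1 X, sboundary d = c & carrier d `<=` U.
Proof.
move=> [_ UVA] AU; have [V AV [VU VU0]] := UVA U AU.
exists V => // k c kn cz cV; pose z := Cycle (chain_lift_cycle cV cz).
have := VU0 k kn (homology_class z); rewrite homology_mapE.
(* Zero is written as the class of the zero cycle, so that equality of classes yields a bounding
   chain. *)
have <- : homology_class (0 : cycles R G k U) = 0 by exact: linear0.
move=> /homology_class_eq[d].
rewrite /= subr0 => dz; exists (chain_map [the continuousType _ _ of @sub_incl U] d).
  by rewrite sboundary_chain_map dz chain_map_set_incl chain_liftK.
exact: carrier_chain_map.
Qed.

End Subspace.

(** * Bases of oriented chains *)

Section OrientedChains.
Variables (G : comPzRingType) (T : choiceType).
Implicit Types (K L : complex T).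

(* vrep t depends only on the simplex, so the t with vrep t = t index a basis of
   the oriented chains. *)
Definition vrep k (t : vtuple T k) : vtuple T k :=
  choose [pred u | [exists p : 'S_k.+1, u == vperm p t]] t.

Lemma vrepP k (t : vtuple T k) : exists p : 'S_k.+1, vrep t = vperm p t.
Proof.
have : [exists p : 'S_k.+1, vrep t == vperm p t].
  apply: (chooseP (P := [pred u | [exists p : 'S_k.+1, u == vperm p t]])).
  by apply/existsP; exists 1%g; rewrite vperm1.
by move=> /existsP[p /eqP]; exists p.
Qed.

(** Both tuples have the same orbit under permutations, and [choose] does not depend on its default
    value within that orbit. *)
Lemma vrep_vperm k (p : 'S_k.+1) (t : vtuple T k) : vrep (vperm p t) = vrep t.
Proof.
rewrite /vrep; transitivity
    (choose [pred u | [exists q : 'S_k.+1, u == vperm q t]] (vperm p t)).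
  apply: eq_choose => u /=; apply/existsP/existsP => -[q /eqP ->].
    by exists (q * p)%g; rewrite vpermM.
  by exists (q * p^-1)%g; rewrite vpermM mulgKV.
by apply: choose_id; apply/existsP; [exists p|exists 1%g; rewrite vperm1].
Qed.

Lemma vperm_eq_inj k (p q : 'S_k.+1) (t : vtuple T k) :
  injective t -> vperm p t = vperm q t -> p = q.
Proof.
by move=> ti /ffunP e; apply/permP => i; apply: ti; have := e i; rewrite !ffunE.
Qed.

Lemma coef_alt k (p : 'S_k.+1) (t : vtuple T k) :
  injective t -> (alt G t)@_(vperm p t) = (-1) ^+ p.
Proof.
move=> ti; rewrite /alt raddf_sum (bigD1 p) //= coefZ coef_gen eqxx mulr1.
rewrite big1 ?addr0 // => q qp; rewrite coefZ coef_gen.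
by case: eqP => [/(vperm_eq_inj ti) e|_]; [rewrite e eqxx in qp|rewrite mulr0].
Qed.

Lemma ordered_vperm K k (p : 'S_k.+1) (t : vtuple T k) :
  ordered_simplex K t -> ordered_simplex K (vperm p t).
Proof.
move=> [ti tK]; split; last by rewrite vset_vperm.
by move=> i j; rewrite !ffunE => /ti /perm_inj.
Qed.

Lemma ochain_vperm K k (c : ochain G K k) (p : 'S_k.+1) t :
  (\val c)@_(vperm p t) = (-1) ^+ p * (\val c)@_t.
Proof. by case: c => c /= /asboolP[]. Qed.

Lemma ochain_ordered K k (c : ochain G K k) t :
  (\val c)@_t != 0 -> ordered_simplex K t.
Proof. by case: c => c /= /asboolP[_]; apply. Qed.

(** By antisymmetry the value of [c] at the representative determines [c] on the whole orbit, and
    the chains [alt] of different orbits have disjoint supports. So only the term of [vrep u] can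
    contribute at [u]. *)
Lemma ochain_alt K k (c : ochain G K k) :
  \val c = \sum_(t <- msupp (\val c) | vrep t == t) (\val c)@_t *: alt G t.
Proof.
apply/malgP => u.
transitivity (\sum_(t <- msupp (\val c) | vrep t == t) (\val c)@_t * (alt G t)@_u).
  2: by rewrite raddf_sum; apply: eq_bigr => t _; rewrite /= coefZ.
(* If [c] vanishes at [u], it vanishes on the orbit of [u], and no term of the sum reaches [u]. *)
have [cu|cu] := eqVneq ((\val c)@_u) 0.
  rewrite cu big1 // => t tr.
  have [->|ct] := eqVneq ((\val c)@_t) 0; first by rewrite mul0r.
  rewrite /alt raddf_sum /= big1 ?mulr0 // => p _; rewrite coefZ coef_gen.
  case: eqP => [pu|_]; last by rewrite mulr0.
  move: cu; rewrite -pu ochain_vperm => c0.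
  by rewrite -[(\val c)@_t](signrMK p) c0 mulr0 eqxx in ct.
have [p pE] := vrepP u; have [ui _] := ochain_ordered cu.
have ri : injective (vrep u) by rewrite pE => i j; rewrite !ffunE => /ui /perm_inj.
have uE : u = vperm p^-1 (vrep u) by rewrite pE vpermM mulVg vperm1.
have cr : (\val c)@_(vrep u) = (-1) ^+ p * (\val c)@_u by rewrite pE ochain_vperm.
rewrite big_mkcond (bigD1_seq (vrep u)) ?fset_uniq //=; last first.
  rewrite -mcoeff_neq0 cr; apply: contra_neq cu => c0.
  by rewrite -[LHS](signrMK p) c0 mulr0.
have rr : vrep (vrep u) = vrep u by rewrite {1}pE vrep_vperm.
have au : (alt G (vrep u))@_u = (-1) ^+ p.
  by rewrite [X in _@_X]uE coef_alt // odd_permV.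
rewrite rr eqxx au cr.
(* The sign of passing to the representative cancels the sign inside [alt]. *)
rewrite mulrAC -signr_addb addbb mul1r big1 ?addr0 // => t tr.
case: ifP => [/eqP rt|//].
rewrite /alt raddf_sum /= big1 ?mulr0 // => q _; rewrite coefZ coef_gen.
case: eqP => [qt|_]; last by rewrite mulr0.
by rewrite -qt vrep_vperm rt eqxx in tr.
Qed.

(* The elementary chain of t, with the junk value 0 when t is not an ordered
   simplex of K, so that no proof of that is carried along. *)
Definition ogen K k (t : vtuple T k) : ochain G K k :=
  if pselect (ordered_simplex K t) is left tK then elementary G tK else 0.

Lemma ogenE K k (t : vtuple T k) (tK : ordered_simplex K t) :
  ogen K t = elementary G tK.
Proof.
rewrite /ogen; case: pselect => // tK'.
by congr elementary; exact: Prop_irrelevance.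
Qed.

Lemma val_ogen K k (t : vtuple T k) : ordered_simplex K t ->
  \val (ogen K t) = alt G t.
Proof. by move=> tK; rewrite (ogenE tK). Qed.

Lemma ogen_vperm K k (p : 'S_k.+1) (t : vtuple T k) : ordered_simplex K t ->
  ogen K (vperm p t) = (-1) ^+ p *: ogen K t.
Proof.
move=> tK; apply/val_inj; rewrite linearZ /= !val_ogen //; last exact: ordered_vperm.
rewrite /alt scaler_sumr (reindex_inj (mulIg p^-1%g)) /=.
apply: eq_bigr => q _; rewrite vpermM mulgKV scalerA odd_permM odd_permV.
by rewrite addbC signr_addb.
Qed.

Lemma ochain_ogen K k (c : ochain G K k) :
  c = \sum_(t <- msupp (\val c) | vrep t == t) (\val c)@_t *: ogen K t.
Proof.
apply/val_inj; rewrite {1}ochain_alt raddf_sum big_seq_cond [RHS]big_seq_cond.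
apply: eq_bigr => t /andP[]; rewrite -mcoeff_neq0 => /ochain_ordered tK _.
by rewrite [RHS]linearZ /= val_ogen.
Qed.

(* Pairing p with s * p avoids dividing by 2, which may be 0 in G. *)
Lemma sum_sign_invol n (M : lmodType G) (F : 'S_n -> M) (s : 'S_n) :
  s -> (forall p, F (s * p)%g = F p) -> \sum_(p : 'S_n) (-1) ^+ p *: F p = 0.
Proof.
move=> odd_s Fs; rewrite (bigID (@odd_perm _)) /= (reindex_inj (mulgI s)) /=.
rewrite -[RHS](subrr (\sum_(p : 'S_n | ~~ p) F p)) addrC; congr (_ + _).
  by apply: eq_bigr => p /negPf ->; rewrite scale1r.
rewrite -sumrN; apply: eq_big => p; rewrite odd_permM odd_s //=.
by move=> /negPf ->; rewrite Fs expr1 scaleN1r.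
Qed.

(** Transposing the two dropped vertices flips the sign and leaves the remaining tuple alone. *)
Lemma otail_otail k (t : vtuple T k.+2) : otail (otail (alt G t)) = 0.
Proof.
rewrite /alt [otail (\sum_p _)]linear_sum linear_sum /=.
pose F (p : 'S_k.+3) := gen G (vdrop ord0 (vdrop ord0 (vperm p t))).
rewrite -[RHS](@sum_sign_invol _ _ F (tperm ord0 (lift ord0 ord0))).
- by apply: eq_bigr => p _; rewrite !linearZ /= /otail !linext_gen.
- by rewrite odd_tperm.
- move=> p; rewrite /F -vpermM; congr gen; apply/ffunP => i; rewrite !ffunE.
  by rewrite tpermD.
Qed.

Lemma aug_otail (t : vtuple T 1) : @linext G _ G^o (fun=> 1) (otail (alt G t)) = 0.
Proof.
rewrite /alt [otail (\sum_p _)]linear_sum linear_sum /=.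
apply: etrans (@sum_sign_invol _ G^o (fun=> 1) (tperm ord0 (lift ord0 ord0)) _ _).
- by apply: eq_bigr => p _; rewrite !linearZ /= /otail !linext_gen.
- by rewrite odd_tperm.
- by [].
Qed.

(** Reading coefficients at representatives only counts each simplex once, so values of [F] can be
    prescribed freely there and no division by (k + 1)! occurs. *)
Definition oext K k (M : lmodType G) (F : vtuple T k -> M) (c : ochain G K k) : M :=
  linext (fun t => if vrep t == t then F t else 0) (\val c).

Fact oext_is_linear K k (M : lmodType G) (F : vtuple T k -> M) :
  linear (@oext K k M F).
Proof. by move=> a c d; rewrite /oext !linearP. Qed.

HB.instance Definition _ K k (M : lmodType G) (F : vtuple T k -> M) :=
  GRing.isLinear.Build G (ochain G K k) M _ (@oext K k M F)
    (@oext_is_linear K k M F).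

Lemma oext_ogen K k (M : lmodType G) (F : vtuple T k -> M) t :
  ordered_simplex K t -> vrep t = t -> oext F (ogen K t) = F t.
Proof.
move=> tK tr; rewrite /oext val_ogen // /alt linear_sum (bigD1 1%g) //=.
rewrite odd_perm1 scale1r linext_gen vperm1 tr eqxx big1 ?addr0 // => p p1.
rewrite linearZ /= linext_gen vrep_vperm tr; case: eqP => [e|_]; last exact: scaler0.
case/eqP: p1; apply: (vperm_eq_inj tK.1); by rewrite -e vperm1.
Qed.

Lemma eq_linear_ochain K k (M : lmodType G) (g h : {linear ochain G K k -> M}) :
  (forall t, ordered_simplex K t -> vrep t = t -> g (ogen K t) = h (ogen K t)) ->
  g =1 h.
Proof.
move=> gh c; rewrite [c]ochain_ogen !linear_sum /= big_seq_cond [RHS]big_seq_cond.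
apply: eq_bigr => t /andP[]; rewrite -mcoeff_neq0 => /ochain_ordered tK /eqP tr.
by rewrite !linearZ /= gh.
Qed.

Lemma eq_linear_ochain_sub K L k (M : lmodType G)
    (g : {linear ochain G K k -> M}) (h : {linear ochain G L k -> M}) :
  (forall t : vtuple T k, ordered_simplex L t -> ordered_simplex K t) ->
  (forall t, ordered_simplex L t -> vrep t = t -> g (ogen K t) = h (ogen L t)) ->
  forall c d, \val c = \val d -> g c = h d.
Proof.
move=> LK gh c d cd; rewrite [c]ochain_ogen [d]ochain_ogen !linear_sum /= cd.
rewrite big_seq_cond [RHS]big_seq_cond; apply: eq_bigr => t /andP[].
rewrite -mcoeff_neq0 => /ochain_ordered tL /eqP tr.
by rewrite !linearZ /= gh.
Qed.

Lemma val_obd_ogen K k (t : vtuple T k.+1) : ordered_simplex K t ->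
  \val (oboundary (ogen K t)) = otail (alt G t).
Proof. by move=> tK; rewrite (ogenE tK). Qed.

(** This exhibits the boundary of a simplex that may lie outside [L] as a chain of [L], to which a
    morphism defined on [L] applies. *)
Lemma otail_alt_faces K L k (t : vtuple T k.+1) : ordered_simplex K t ->
  (forall i, ordered_simplex L (vdrop i t)) ->
  \val (\sum_(i < k.+2) (-1) ^+ i *: ogen L (vdrop i t)) = otail (alt G t).
Proof.
move=> tK tL; rewrite -(val_obd_ogen tK) (ogenE tK) oboundary_elementary.
rewrite [LHS]raddf_sum [RHS]raddf_sum; apply: eq_bigr => i _.
by rewrite [LHS]linearZ [RHS]linearZ /= val_ogen.
Qed.

End OrientedChains.

(** * Extending chain morphisms *)

Section Extension.
Variables (R : realType) (G : comPzRingType) (T : choiceType).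
Variable X : topologicalType.

Lemma morphism_obd (L : complex T) (phi : chain_morphism R G X L) k
    (t : vtuple T k.+1) : ordered_simplex L t ->
  sboundary (phi k.+1 (ogen G L t)) =
  phi k (\sum_(i < k.+2) (-1) ^+ i *: ogen G L (vdrop i t)).
Proof.
move=> tL; rewrite morphism_boundary; congr (phi k _); apply/val_inj.
rewrite (otail_alt_faces G tL); first exact: val_obd_ogen.
by move=> i; apply: vdrop_ordered.
Qed.

(** All proper faces of new simplices are old, so commuting with the boundary is a separate
    condition on each new simplex and the values can be chosen independently. [P] will bound
    carriers; it is returned at representatives, where [psi] takes the chosen values. *)
Lemma extend_morphism (L L' : complex T) (phi : chain_morphism R G X L)
    (P : forall k, vtuple T k -> schain R G k X -> Prop) :
  subcomplex L L' ->
  (forall t : vtuple T 0, ordered_simplex L' t -> ordered_simplex L t) ->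
  (forall k (t : vtuple T k.+1), ordered_simplex L' t ->
    forall i, ordered_simplex L (vdrop i t)) ->
  (forall k (t : vtuple T k), ordered_simplex L t -> P k t (phi k (ogen G L t))) ->
  (forall k (t : vtuple T k.+1), ordered_simplex L' t -> ~ ordered_simplex L t ->
    exists2 x, P k.+1 t x &
      sboundary x = phi k (\sum_(i < k.+2) (-1) ^+ i *: ogen G L (vdrop i t))) ->
  exists psi : chain_morphism R G X L', extends psi phi /\
    forall k (t : vtuple T k), ordered_simplex L' t -> vrep t = t ->
      P k t (psi k (ogen G L' t)).
Proof.
move=> LL' vL fL PL newP.
have LL't k (t : vtuple T k) : ordered_simplex L t -> ordered_simplex L' t.
  by move=> [ti tL]; split=> //; apply: LL'.
(* Degree 0 imposes nothing: the vertices are old and keep their values under [phi]. *)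
pose bd k := match k return vtuple T k -> schain R G k X -> Prop with
  | 0 => fun _ _ => True
  | k'.+1 => fun t x => sboundary x =
      phi k' (\sum_(i < k'.+2) (-1) ^+ i *: ogen G L (vdrop i t))
  end.
have ex k (t : vtuple T k) : exists x, ordered_simplex L' t ->
    [/\ P k t x, ordered_simplex L t -> x = phi k (ogen G L t) & bd k t x].
  have [tL|tL] := pselect (ordered_simplex L t).
    exists (phi k (ogen G L t)) => _; split=> //; first exact: PL.
    by case: k t tL => [//|k] t tL; apply: morphism_obd.
  have [tL'|] := pselect (ordered_simplex L' t); last by exists 0.
  case: k t tL tL' => [t tL tL'|k t tL tL']; first by case: tL; apply: vL.
  by have [x Px bdx] := newP k t tL' tL; exists x.
pose F k (t : vtuple T k) := projT1 (cid (ex k t)).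
have FP k (t : vtuple T k) := projT2 (cid (ex k t)).
pose psi k : {linear ochain G L' k -> schain R G k X} :=
  @oext G T L' k (schain R G k X) (F k).
have psi_ogen k (t : vtuple T k) : ordered_simplex L' t -> vrep t = t ->
    psi k (ogen G L' t) = F k t by exact: oext_ogen.
have psiE k (c' : ochain G L' k) (c : ochain G L k) :
    \val c' = \val c -> psi k c' = phi k c.
  apply: eq_linear_ochain_sub; first exact: LL't.
  move=> t tL tr; rewrite psi_ogen //; last exact: LL't.
  by have [_ + _] := FP k t (LL't k t tL); apply.
have psi_bd k (c : ochain G L' k.+1) : sboundary (psi k.+1 c) = psi k (oboundary c).
  move: c; apply: (@eq_linear_ochain G T L' k.+1 (schain R G k X)
    (@sboundary R G k X \o psi k.+1) (psi k \o @oboundary G T L' k)) => t tL' tr.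
  rewrite /= psi_ogen //; have [_ _ ->] := FP k.+1 t tL'.
  (* The boundary of [t] is a chain of [L], where [psi] agrees with [phi]. *)
  apply/esym/psiE; rewrite val_obd_ogen // (otail_alt_faces G tL') //.
  exact: fL.
have psi_aug (c : ochain G L' 0) : saug (psi 0 c) = oaug c.
  move: c; apply: (@eq_linear_ochain G T L' 0 G^o
    (@saug R G X \o psi 0) (@oaug G T L')) => t tL' tr.
  have tL := vL t tL'; rewrite /= (psiE 0 _ (ogen G L t)) ?val_ogen //.
  by rewrite morphism_aug /oaug !val_ogen.
exists (ChainMorphism psi_bd psi_aug); split=> [k c c' cc'|k t tL' tr] /=.
  exact: psiE.
by rewrite psi_ogen //; have [] := FP k t tL'.
Qed.

(** Since [t] may lie outside [L], the argument stays with its boundary: the boundary of that chain,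
    or its augmentation when [t] is an edge, is already zero in the oriented chains of [L]. *)
Lemma morphism_faces_cycle (L L' : complex T) (phi : chain_morphism R G X L) k
    (t : vtuple T k.+1) : ordered_simplex L' t ->
  (forall i, ordered_simplex L (vdrop i t)) ->
  phi k (\sum_(i < k.+2) (-1) ^+ i *: ogen G L (vdrop i t)) \in @is_cycle R G k X.
Proof.
move=> tL' tL; have cE := otail_alt_faces G tL' tL.
move: (\sum_(i < k.+2) _) cE => c cE; case: k t tL' tL c cE => [|k] t tL' tL c cE.
  by rewrite unfold_in /= morphism_aug /oaug cE aug_otail.
rewrite unfold_in /= morphism_boundary [oboundary c](_ : _ = 0) ?linear0 //.
by apply/val_inj; rewrite /= -[ochain_val c]/(\val c) cE otail_otail.
Qed.

End Extension.

(** * The zero ring, singular points and vertex tuples *)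

Lemma trivial_lmod (G : comPzRingType) (M : lmodType G) (x y : M) :
  1 = 0 :> G -> x = y.
Proof. by move=> e; rewrite -[x]scale1r -[y]scale1r e !scale0r. Qed.

Lemma stdsimplex0_inhabited (R : realType) : inhabited (stdsimplex R 0).
Proof.
have x1 : (const_mx 1 : 'rV[R]_1) \in stdsimplex R 0.
  apply/mem_set; split=> [i|]; first by rewrite mxE ler01.
  by rewrite big_ord1 mxE.
exact: (inhabits (exist (fun y => y \in stdsimplex R 0) _ x1)).
Qed.

Lemma carrier_gen_neq0 (R : realType) (G : comPzRingType) (X : topologicalType)
    (s : singular R 0 X) : 1 != 0 :> G -> carrier (gen G s) !=set0.
Proof.
move=> G1; have [x] := stdsimplex0_inhabited R.
by exists (s x), s; [rewrite /= -mcoeff_neq0 coef_gen eqxx|exists x].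
Qed.

Section VertexTuples.
Variable T : choiceType.
Implicit Types K L : complex T.

Lemma vset1 (t : vtuple T 0) : vset t = [fset t ord0]%fset.
Proof.
apply/fsetP => x; rewrite inE; apply/in_vset/eqP => [[i <-]|->].
  by rewrite [i]ord1.
by exists ord0.
Qed.

Lemma card_vset k (t : vtuple T k) : injective t -> #|` vset t| = k.+1.
Proof. by move=> ti; rewrite card_imfset //= -cardE card_ord. Qed.

Lemma vset_vdrop k (i : 'I_k.+2) (t : vtuple T k.+1) :
  (vset (vdrop i t) `<=` vset t)%fset.
Proof.
apply/fsubsetP => x /in_vset[j <-]; apply/in_vset.
by exists (lift i j); rewrite ffunE.
Qed.

Lemma ordered_vertex K k (t : vtuple T k) i : ordered_simplex K t ->
  ordered_simplex K ([ffun=> t i] : vtuple T 0).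
Proof.
move=> [ti tK]; split=> [a b _|]; first by rewrite !ord1.
rewrite vset1 ffunE; apply: simplex_face tK _ _.
  by rewrite fsub1set; apply/in_vset; exists i.
by apply/fset0Pn; exists (t i); rewrite inE.
Qed.

Lemma contains_ordered_vertex K L (t : vtuple T 0) : contains_vertices L K ->
  ordered_simplex K t -> ordered_simplex L t.
Proof.
by move=> LK [ti tK]; split=> //; move: tK; rewrite vset1; apply: LK.
Qed.

Lemma subcomplex_ordered K L k (t : vtuple T k) : subcomplex L K ->
  ordered_simplex L t -> ordered_simplex K t.
Proof. by move=> LK [ti tL]; split=> //; apply: LK. Qed.

End VertexTuples.

(** * One extension step and its iteration *)

Section Steps.
Variables (R : realType) (G : comPzRingType) (n : nat).
Variables (X Y : topologicalType) (f : X -> Y).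
Hypotheses (f_cts : continuous f) (f_closed : closed_map f).
Hypothesis f_UV : homologically_UV_map R G n f.

Definition fills (O B : set Y) : Prop :=
  forall k (c : schain R G k X), (k <= n)%N -> c \in @is_cycle R G k X ->
    carrier c `<=` f @^-1` O ->
    exists2 d : schain R G k.+1 X, sboundary d = c & carrier d `<=` f @^-1` B.

Lemma UV_fills (y : Y) (B : set Y) : open B -> B y ->
  exists O : set Y, [/\ open O, O y, O `<=` B & fills O B].
Proof.
move=> Bo By.
have nB : set_nbhs (f @^-1` [set y]) (f @^-1` B).
  move=> x fx; apply: f_cts; apply: open_nbhs_nbhs; split=> //.
  by rewrite [f x]fx.
have [V /set_nbhsP[C [Co fC CV]] Vbd] := UV_cycle_boundary (f_UV.2 y) nB.
(* A tube around the fibre: it is open because [f] is closed, contains [y] because the fibre lies in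
   [C], and has its preimage inside [C]. *)
exists (B `&` ~` (f @` (~` C))); split.
- by apply: openI => //; rewrite openC; apply: f_closed; rewrite closedC.
- by split=> // -[x Cx fx]; apply: Cx; apply: fC.
- by move=> z [].
- move=> k c kn cz cO; apply: Vbd => // x /cO[_ fx]; apply: CV.
  by apply: contrapT => Cx; apply: fx; exists x.
Qed.

(** Smallness is measured on the simplices of all of [K], before and after, so that successive steps
    compose. *)
Definition extension_refinement (V U : set (set Y)) : Prop :=
  forall (T : choiceType) (K L L' : complex T) (phi : chain_morphism R G X L),
    subcomplex L L' -> subcomplex L' K ->
    (forall k (t : vtuple T k.+1), ordered_simplex L' t -> ~ ordered_simplex L t ->
      (k <= n)%N /\ forall i, ordered_simplex L (vdrop i t)) ->
    partial_realization (preimage_cover f V) K phi -> correct phi ->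
    exists psi : chain_morphism R G X L',
      extends psi phi /\ partial_realization (preimage_cover f U) K psi.

Lemma extension_step (U : set (set Y)) : paracompact Y -> open_cover U ->
  exists V, [/\ open_cover V, refines V U & extension_refinement V U].
Proof.
move=> paraY coverU.
have faces (T : choiceType) (L L' : complex T) :
    (forall k (t : vtuple T k.+1), ordered_simplex L' t -> ~ ordered_simplex L t ->
      (k <= n)%N /\ forall i, ordered_simplex L (vdrop i t)) ->
    forall k (t : vtuple T k.+1), ordered_simplex L' t ->
      forall i, ordered_simplex L (vdrop i t).
  move=> new k t tL' i; have [tL|tL] := pselect (ordered_simplex L t).
    exact: vdrop_ordered.
  by have [] := new k t tL' tL.
(* Over the zero ring vertices have empty carriers, so they do not make the
   sets B_t and B_s meet; but then all chains are 0. *)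
have [G1|G1] := eqVneq (1 : G) 0.
  exists U; split=> // [A UA|T K L L' phi LL' L'K new [LK KL phiU] _].
    by exists A.
  have [|||psi [psi_phi _]] := extend_morphism (P := fun _ _ _ => True)
      (phi := phi) LL' _ (faces _ _ _ new).
  - move=> t /(subcomplex_ordered L'K); exact: contains_ordered_vertex.
  - by [].
  - by move=> k t _ _; exists 0 => //; apply: trivial_lmod.
  exists psi; split=> //; split=> // [v /KL/LL'//|s /phiU[A UA _]].
  exists A => // k t tL' _.
  by rewrite (trivial_lmod (psi k (elementary G tL')) 0 G1); apply: carrier0.
have [W coverW WU] := star_refinement paraY coverU.
have tube y : exists OB : set Y * set Y,
    [/\ open OB.1, OB.1 y, W OB.2, OB.1 `<=` OB.2 & fills OB.1 OB.2].
  have [B WB By] := cover_ex y coverW.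
  have Bo : open B by case: coverW => + _; apply.
  by have [O [? ? ? ?]] := UV_fills Bo By; exists (O, B).
have [OB OBP] := choice tube.
exists (range (fst \o OB)); split.
- split=> [_ [y _ <-]|]; first by case: (OBP y).
  by rewrite -subTset => y _; exists (OB y).1; [exists y|case: (OBP y)].
- move=> _ [y _ <-]; have [_ Oy Wy OBy _] := OBP y.
  have [|A UA WA] := WU _ Wy; first by exists y; apply: OBy.
  exists A => //= z Oz; apply: WA; exists (OB y).2; last exact: OBy.
  by split=> //; exists y; split; apply: OBy.
move=> T K L L' phi LL' L'K new [LK KL phiV] phi_correct.
(* Each simplex [s] of [K] receives a pair: an open set over which [phi] carries the faces of [s] in
   [L], and a larger member of [W] over which the cycles of the first one bound. Outside [K] the
   pair is a dummy. *)
have data s : exists ab : set Y * set Y, K s ->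
    [/\ W ab.2, ab.2 !=set0, ab.1 `<=` ab.2, fills ab.1 ab.2 &
      forall k (t : vtuple T k), ordered_simplex L t -> (vset t `<=` s)%fset ->
        carrier (phi k (ogen G L t)) `<=` f @^-1` ab.1].
  have [Ks|] := pselect (K s); last by exists (set0, set0).
  have [_ [_ [y _ <-] <-] phiA] := phiV s Ks; have [_ Oy Wy OBy fill] := OBP y.
  exists (OB y) => _; split=> //; first by exists y; apply: OBy.
  by move=> k t tL ts; rewrite (ogenE G tL); apply: phiA.
have [ab abP] := choice data.
have KL't k (t : vtuple T k) : ordered_simplex L' t -> K (vset t).
  by move=> [_ tL']; apply: L'K.
have [|||psi [psi_phi psiB]] := extend_morphism
    (P := fun k t x => carrier x `<=` f @^-1` (ab (vset t)).2)
    (phi := phi) LL' _ (faces _ _ _ new).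
- by move=> t /(subcomplex_ordered L'K); apply: contains_ordered_vertex.
- move=> k t tL; have [_ _ Oab _ phiO] := abP _ (LK _ tL.2).
  by apply: (subset_trans (phiO k t tL _)) => // x; apply: Oab.
- move=> k t tL' tL; have [kn tfaces] := new k t tL' tL.
  have [_ _ _ fill phiO] := abP _ (KL't _ _ tL').
  have [|d dc dB] := fill k _ kn (morphism_faces_cycle phi tL' tfaces).
    (* The faces of [t] are faces of the simplex [vset t], so their values all lie over the first
       set of its pair. *)
    rewrite linear_sum; apply: carrier_sum => i _; rewrite linearZ.
    by apply: carrierZ; apply: phiO => //; apply: vset_vdrop.
  by exists d.
exists psi; split=> //; split=> // [v /KL/LL'//|s Ks].
have [Wb b0 _ _ phis] := abP s Ks; have [A UA bA] := WU _ Wb b0.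
exists (f @^-1` A); first by exists A.
move=> k t tL' ts.
have [Wt _ Ot _ phit] := abP _ (KL't _ _ tL').
(* [psiB] covers representatives only; another ordering changes the value by a sign and keeps the
   vertex set. *)
have tb : carrier (psi k (elementary G tL')) `<=` f @^-1` (ab (vset t)).2.
  rewrite -ogenE; have [p pE] := vrepP t.
  have tE : t = vperm p^-1 (vrep t) by rewrite pE vpermM mulVg vperm1.
  have rL' : ordered_simplex L' (vrep t) by rewrite pE; apply: ordered_vperm.
  rewrite {1}tE ogen_vperm // linearZ; apply: carrierZ.
  have -> : vset t = vset (vrep t) by rewrite pE vset_vperm.
  by apply: psiB => //; rewrite {1}pE vrep_vperm.
(* The sets of [t] and [s] meet: the value of [phi] at a vertex of [t] is a singular point [w], and
   [f w] lies in both, as the vertex is a face of [t] and of [s]. *)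
apply: subset_trans tb _ => x tx; apply: bA; exists (ab (vset t)).2 => //.
split=> //; pose v : vtuple T 0 := [ffun=> t ord0].
have vL : ordered_simplex L v.
  apply: contains_ordered_vertex KL _.
  exact/(subcomplex_ordered L'K)/ordered_vertex.
have vt : (vset v `<=` vset t)%fset.
  by rewrite vset1 ffunE fsub1set; apply/in_vset; exists ord0.
have [w vw] : carrier (phi 0 (ogen G L v)) !=set0.
  have [s0 s0E] := phi_correct v vL.
  by rewrite (ogenE G vL) s0E; apply: carrier_gen_neq0.
have [_ _ Os _ _] := abP s Ks.
exists (f w); split; first by apply: Ot; apply: (phit _ _ vL vt).
by apply: Os; apply: (phis _ _ vL) vw; apply: fsubset_trans ts.
Qed.

Lemma extends_trans (T : choiceType) (L L' K : complex T)
    (phi : chain_morphism R G X L) (psi : chain_morphism R G X L')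
    (chi : chain_morphism R G X K) :
  subcomplex L L' -> extends psi phi -> extends chi psi -> extends chi phi.
Proof.
move=> LL' psi_phi chi_psi k c c' cc'.
(* The chain is read again as a chain of the intermediate complex, with the same underlying
   function. *)
have cL' : \val c \in @is_ochain G T L' k.
  case: c {cc'} => c /= /asboolP[cp cL]; apply/asboolP; split=> // t /cL.
  exact: subcomplex_ordered.
by rewrite (chi_psi k (OChain cL')) //; apply: psi_phi.
Qed.

(* The complex L already contains all simplices of dimension at most n - i, which
   leaves i + 1 extension steps. *)
Lemma extension_iter (i : nat) (U : set (set Y)) :
  paracompact Y -> (i <= n)%N -> open_cover U ->
  exists V, [/\ open_cover V, refines V U &
    forall (T : choiceType) (K L : complex T) (phi : chain_morphism R G X L),
      (forall s, K s -> (#|` s| <= n.+2)%N) ->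
      (forall s, K s -> (#|` s| + i <= n.+1)%N -> L s) ->
      partial_realization (preimage_cover f V) K phi -> correct phi ->
      exists psi : chain_morphism R G X K,
        extends psi phi /\ full_realization (preimage_cover f U) psi].
Proof.
move=> paraY; elim: i U => [|i IH] U ni coverU.
  have [V [coverV VU ext]] := extension_step paraY coverU.
  exists V; split=> // T K L phi dimK KL phiV phi_correct.
  have [LK _ _] := phiV.
  (* The last step adjoins all of [K]: simplices have at most n + 2 vertices, so their facets have
     at most n + 1 and lie in [L]. *)
  apply: (ext T K L K phi) => // k t tK _; split=> [|j].
    by have := dimK _ tK.2; rewrite card_vset //; case: tK.
  have [dj djK] := vdrop_ordered j tK; split=> //; apply: KL => //.
  by rewrite addn0 card_vset //; have := dimK _ tK.2; rewrite card_vset //; case: tK.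
(* Covers are built from the last step backwards: [V1] serves the remaining i + 1 steps, [V] the
   first one. *)
have [V1 [coverV1 V1U ext1]] := IH U (ltnW ni) coverU.
have [V [coverV VV1 ext]] := extension_step paraY coverV1.
exists V; split=> // [A /VV1[B /V1U[C UC BC] AB]|].
  by exists C => //; apply: subset_trans BC.
move=> T K L phi dimK KL phiV phi_correct; have [LK KLv _] := phiV.
(* This adjoins the simplices of dimension n - i, one more than [L] is known to contain. *)
pose L'P s := K s /\ (L s \/ (#|` s| + i <= n.+1)%N).
have L'0 s : L'P s -> s != fset0 by case=> /simplex_neq0.
have L'f s t : L'P s -> (t `<=` s)%fset -> t != fset0 -> L'P t.
  move=> [Ks sL] ts t0; split; first exact: simplex_face Ks ts t0.
  case: sL => [sL|si]; [left; exact: simplex_face sL ts t0|right].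
  by apply: leq_trans si; rewrite leq_add2r fsubset_leq_card.
pose L' := Complex L'0 L'f.
have LL' : subcomplex L L' by move=> s Ls; split; [exact: LK|left].
have L'K : subcomplex L' K by move=> s [].
have [|psi [psi_phi psiV1]] := ext T K L L' phi LL' L'K _ phiV phi_correct.
  move=> k t [ti [tK [tL|ci]]] ntL; first by case: ntL.
  rewrite card_vset // in ci; split.
    by apply: ltnW; rewrite -ltnS; apply: leq_trans ci; apply: leq_addr.
  move=> j; have [dj djK] := vdrop_ordered j (conj ti tK).
  by split=> //; apply: KL => //; rewrite card_vset // addnS -addSn.
have [||chi [chi_psi chiU]] := ext1 T K L' psi dimK _ psiV1.
- by move=> s Ks si; split=> //; right.
(* Correctness persists because every vertex already lies in [L], where [psi] equals [phi]. *)
- move=> t tL'; have tL : ordered_simplex L t.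
    by apply: contains_ordered_vertex KLv _; apply: subcomplex_ordered tL'.
  have [s sE] := phi_correct t tL; exists s; rewrite -sE.
  exact: psi_phi.
by exists chi; split=> //; apply: extends_trans psi_phi chi_psi.
Qed.

End Steps.

Theorem proposition3p1 (R : realType) (G : comPzRingType) (n : nat)
    (X Y : topologicalType) (f : X -> Y)
    (paraX : paracompact X) (paraY : paracompact Y)
    (f_cts : continuous f) (f_closed : closed_map f)
    (f_UV : homologically_UV_map R G n f)
    (U : set (set Y)) (U_cover : open_cover U) :
  exists V : set (set Y), [/\ open_cover V, refines V U &
    forall (T : choiceType) (K L : complex T) (phi : chain_morphism R G X L),
      has_dim K n.+1 ->
      partial_realization (preimage_cover f V) K phi -> correct phi ->
      exists psi : chain_morphism R G X K,
        extends psi phi /\ full_realization (preimage_cover f U) psi].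
Proof.
have [V [coverV VU ext]] :=
  extension_iter f_cts f_closed f_UV paraY (leqnn n) U_cover.
exists V; split=> // T K L phi [_ dimK] phiV; apply: ext => // s Ks.
(* With i = n the iteration asks [L] to contain only the simplices with one vertex. *)
rewrite -add1n leq_add2r => s1; have [_ KL _] := phiV.
have /cardfs1P[v sE] : #|` s| == 1%N.
  by rewrite eqn_leq s1 cardfs_gt0 (simplex_neq0 Ks).
by rewrite sE in Ks *; apply: KL.
Qed.
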